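(* Let $a,b,\mu,\nu\geq1$ be real numbers. (i) If $b\geq\psi_1(a)$, where $$\psi_1(a)=\frac{(3-a)+\sqrt{a^2+2a+9}}{2a},$$ then $\mathbb{W}_{(\mu,a),(\nu,b)}(z)$ is convex in $\mathbb{D}_{1/2}$. (ii) If $b\geq\psi_2(a)$, where $$\psi_2(a)=\frac{\sqrt{5}(2a+3)-2a^2+\sqrt{4a^4+8\sqrt{5}a^3+20(1+\sqrt{5})a^2+4(15+4\sqrt{5})a+45}}{4a(a+1)},$$ then $\mathbb{W}_{(\mu,a),(\nu,b)}(z)$ is starlike in $\mathbb{D}$.
   Context: $\mathbb{D}=\{z\in\mathbb{C}:|z|<1\}$ and $\mathbb{D}_{1/2}=\{z\in\mathbb{C}:|z|<1/2\}$. The normalized four parameters Wright function is $$\mathbb{W}_{(\mu,a),(\nu,b)}(z)=\sum_{k=0}^{\infty}\frac{\Gamma(a)\Gamma(b)}{\Gamma(a+k\mu)\Gamma(b+k\nu)}\,z^{k+1}.$$ For a disk $D$ centered at $0$ and $f$ analytic with $f(0)=0$, $f'(0)=1$: $f$ is starlike in $D$ if it is univalent in $D$ and $f(D)$ is star-shaped with respect to $0$ (equivalently $\Re(zf'(z)/f(z))>0$ on $D$); $f$ is convex in $D$ if it is univalent in $D$ and $f(D)$ is a convex domain (equivalently $\Re(1+zf''(z)/f'(z))>0$ on $D$). *)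

(* Defs.v *)
From Stdlib Require Import Reals Lra.
From Coquelicot Require Import Coquelicot.

Open Scope R_scope.

(* Euler's integral.  It converges exactly for 0 < x, and Gamma is only ever
   evaluated at such x below. *)
Definition Gamma (x : R) : R :=
  RInt_gen (fun t : R => Rpower t (x - 1) * exp (- t))
           (at_right 0) (Rbar_locally p_infty).

(* The sum of a convergent complex series, as a total function.  Coquelicot's
   Series is real-valued; see C_Series_unique. *)
Definition C_Series (u : nat -> C) : C :=
  (Series (fun n => Re (u n)), Series (fun n => Im (u n))).

Lemma C_sum_n (u : nat -> C) (n : nat) :
  sum_n u n = (sum_n (fun k => Re (u k)) n, sum_n (fun k => Im (u k)) n).
Proof.
induction n as [|n IH].
- rewrite !sum_O; destruct (u 0%nat); reflexivity.
- rewrite !sum_Sn, IH; reflexivity.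
Qed.

Lemma C_Series_unique (u : nat -> C) (l : C) :
  is_series u l -> C_Series u = l.
Proof.
intros H; destruct l as [x y]; unfold C_Series; f_equal;
  apply is_series_unique; intros P [eps HP];
  assert (Hb : locally (T := C_UniformSpace) (x, y)
                 (ball (M := C_UniformSpace) (x, y) eps))
    by (exists eps; intros z Hz; exact Hz);
  destruct (H _ Hb) as [N HN]; exists N; intros n Hn;
  apply HP; specialize (HN n Hn); cbv beta in HN;
  rewrite C_sum_n in HN; apply HN.
Qed.

Definition wright (mu a nu b : R) (z : C) : C :=
  C_Series (fun k : nat =>
    (RtoC (Gamma a * Gamma b / (Gamma (a + INR k * mu) * Gamma (b + INR k * nu)))
     * z ^ (k + 1))%C).

Definition Cdisk (r : R) (z : C) : Prop := Cmod z < r.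

Definition image (f : C -> C) (D : C -> Prop) (w : C) : Prop :=
  exists z : C, D z /\ f z = w.

Definition analytic_on (D : C -> Prop) (f : C -> C) : Prop :=
  forall z : C, D z -> ex_derive f z.

Definition univalent_on (D : C -> Prop) (f : C -> C) : Prop :=
  analytic_on D f /\
  forall z1 z2 : C, D z1 -> D z2 -> f z1 = f z2 -> z1 = z2.

Definition normalized (r : R) (f : C -> C) : Prop :=
  analytic_on (Cdisk r) f /\ f (RtoC 0) = RtoC 0 /\
  is_derive f (RtoC 0) (RtoC 1).

Definition star_shaped (S : C -> Prop) : Prop :=
  forall (w : C) (t : R), S w -> 0 <= t <= 1 -> S (RtoC t * w)%C.

Definition convex_set (S : C -> Prop) : Prop :=
  forall (w1 w2 : C) (t : R), S w1 -> S w2 -> 0 <= t <= 1 ->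
    S (RtoC t * w1 + RtoC (1 - t) * w2)%C.

(* A domain is a nonempty connected open set; connectedness is implied by
   convexity. *)
Definition convex_domain (S : C -> Prop) : Prop :=
  (exists w : C, S w) /\ open S /\ convex_set S.

Definition starlike_in (r : R) (f : C -> C) : Prop :=
  normalized r f /\ univalent_on (Cdisk r) f /\
  star_shaped (image f (Cdisk r)).

Definition convex_in (r : R) (f : C -> C) : Prop :=
  normalized r f /\ univalent_on (Cdisk r) f /\
  convex_domain (image f (Cdisk r)).

Definition psi1 (a : R) : R :=
  ((3 - a) + sqrt (a ^ 2 + 2 * a + 9)) / (2 * a).

Definition psi2 (a : R) : R :=
  (sqrt 5 * (2 * a + 3) - 2 * a ^ 2
   + sqrt (4 * a ^ 4 + 8 * sqrt 5 * a ^ 3 + 20 * (1 + sqrt 5) * a ^ 2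
           + 4 * (15 + 4 * sqrt 5) * a + 45))
  / (4 * a * (a + 1)).

(* Main.v *)
(* Write f(z) = sum_k c_k z^(k+1) for the Wright function, so c_0 = 1 and c_k > 0.
   Since Gamma increases on [2, oo), c_k is at most its value for mu = nu = 1,
   where c_(k+1) = c_k / ((a + k)(b + k)); for ab >= 2 and M = (a + 1)(b + 1) this gives
   S := sum_(k>=1) (k + 1) c_k <= (2 + 7/(2M)) / (ab), and either condition
   psi_i(a) <= b makes the right-hand side at most 1.

   For |x|, |y| <= r one has |f(x) - f(y) - (x - y)| <= r S |x - y|, so f is
   injective on the unit disk, and Banach's fixed point theorem inverts it
   locally, on disks of uniform radius inside each smaller disk.  A segment
   starting at f(z_0) is therefore covered step by step as soon as the preimages
   are known to stay in |z| <= rho: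

   - star-shapedness: if |y| <= |x| and 0 <= t <= 1, then
     |x^n - t y^n| <= n |x|^(n-1) |x - t y|, so f(x) = t f(y) with |x| > |y|
     would force x = t y;
   - convexity: if |u|, |v| <= |z| and m = t u + (1 - t) v, then
     |z^n - t u^n - (1 - t) v^n| <= n^2 |z|^(n-1) |z - m|, so
     f(z) = t f(u) + (1 - t) f(v) with |u|, |v| < |z| < 1/2 would force z = m. *)
Require Import Defs.
From Stdlib Require Import Reals Lra Lia Classical_Prop.
From Coquelicot Require Import Coquelicot.
Open Scope R_scope.

(** * Elementary inequalities in the complex plane *)

Lemma Cmod_sqr (z : C) : Cmod z ^ 2 = fst z ^ 2 + snd z ^ 2.
Proof. exact (Cmod2_alt z). Qed.

Lemma Cmod_triangle_minus (x y : C) : Cmod (x - y) <= Cmod x + Cmod y.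
Proof.
  unfold Cminus; rewrite <- (Cmod_opp y); apply Cmod_triangle.
Qed.

Lemma Cmod_minus_sym (x y : C) : Cmod (x - y) = Cmod (y - x).
Proof. rewrite <- Cmod_opp; f_equal; ring. Qed.

Lemma Cmod_le_0 (z : C) : Cmod z <= 0 -> z = RtoC 0.
Proof.
  intros H; apply Cmod_eq_0; apply Rle_antisym; [exact H | apply Cmod_ge_0].
Qed.

Lemma Cpow_diff_le (x y : C) (r : R) (n : nat) :
  Cmod x <= r -> Cmod y <= r ->
  Cmod (x ^ S n - y ^ S n) <= INR (S n) * r ^ n * Cmod (x - y).
Proof.
  intros Hx Hy.
  assert (Hr : 0 <= r) by (generalize (Cmod_ge_0 x); lra).
  induction n as [|n IH].
  - simpl; apply Req_le.
    replace (x * 1 - y * 1)%C with (x - y)%C by ring; ring.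
  - replace (x ^ S (S n) - y ^ S (S n))%C
      with (x * (x ^ S n - y ^ S n) + y ^ S n * (x - y))%C by (simpl; ring).
    eapply Rle_trans; [apply Cmod_triangle|].
    rewrite !Cmod_mult, Cmod_pow.
    assert (H1 : Cmod y ^ S n <= r ^ S n)
      by (apply pow_incr; split; [apply Cmod_ge_0 | exact Hy]).
    assert (H2 := Rmult_le_compat _ _ _ _ (Cmod_ge_0 x) (Cmod_ge_0 _) Hx IH).
    assert (H3 := Rmult_le_compat_r _ _ _ (Cmod_ge_0 (x - y)) H1).
    rewrite (S_INR (S n)); simpl pow in *. lra.
Qed.

(* Induction through R_(n+1) = y R_n - (n + 1) x^n (x - y)^2, where R_n denotes
   x^(n+1) - y^(n+1) - (n + 1) x^n (x - y). *)
Lemma Cpow_taylor2_le (x y : C) (r : R) (n : nat) :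
  Cmod x <= r -> Cmod y <= r ->
  Cmod (x ^ S (S n) - y ^ S (S n) - RtoC (INR (S (S n))) * x ^ S n * (x - y))
  <= INR (S n) * INR (S (S n)) / 2 * r ^ n * Cmod (x - y) ^ 2.
Proof.
  intros Hx Hy.
  assert (Hr : 0 <= r) by (generalize (Cmod_ge_0 x); lra).
  induction n as [|n IH].
  - replace (x ^ 2 - y ^ 2 - RtoC (INR 2) * x ^ 1 * (x - y))%C
      with (- ((x - y) * (x - y)))%C.
    + rewrite Cmod_opp, Cmod_mult; simpl; lra.
    + replace (RtoC (INR 2)) with (RtoC 1 + RtoC 1)%C
        by (rewrite <- RtoC_plus; reflexivity).
      simpl; ring.
  - replace (x ^ S (S (S n)) - y ^ S (S (S n))
             - RtoC (INR (S (S (S n)))) * x ^ S (S n) * (x - y))%C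
      with (y * (x ^ S (S n) - y ^ S (S n) - RtoC (INR (S (S n))) * x ^ S n * (x - y))
            - RtoC (INR (S (S n))) * x ^ S n * ((x - y) * (x - y)))%C.
    + eapply Rle_trans; [apply Cmod_triangle_minus|].
      rewrite (Cmod_mult (RtoC _ * _)), (Cmod_mult (RtoC _)), (Cmod_mult y), Cmod_pow.
      rewrite Cmod_R, (Rabs_pos_eq _ (pos_INR _)), (Cmod_mult (x - y)).
      assert (H1 : Cmod x ^ S n <= r ^ S n)
        by (apply pow_incr; split; [apply Cmod_ge_0 | exact Hx]).
      assert (H2 := Rmult_le_compat _ _ _ _ (Cmod_ge_0 y) (Cmod_ge_0 _) Hy IH).
      assert (H3 : 0 <= INR (S (S n)) * (Cmod (x - y) * Cmod (x - y)))
        by (apply Rmult_le_pos; [apply pos_INR | apply Rle_0_sqr]).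
      assert (H4 := Rmult_le_compat_r _ _ _ H3 H1).
      rewrite (S_INR (S (S n))), (S_INR (S n)) in *.
      simpl pow in *. lra.
    + rewrite (S_INR (S (S n))), RtoC_plus. simpl Cpow; ring.
Qed.

Lemma pow2_le_reg (x y : R) : 0 <= y -> x ^ 2 <= y ^ 2 -> x <= y.
Proof. intros; nra. Qed.

Lemma Cmod_le_sqr (x y : C) : Cmod y <= Cmod x ->
  fst y ^ 2 + snd y ^ 2 <= fst x ^ 2 + snd x ^ 2.
Proof.
  intros H; rewrite <- !Cmod_sqr.
  apply pow_incr; split; [apply Cmod_ge_0 | exact H].
Qed.

(** From |y| <= |x| follows Re (conj x y) <= |x|^2, so |x - s y|^2 - s^2 |x - y|^2 = (1 - s^2) |x|^2
    - 2 s (1 - s) Re (conj x y) is at least (1 - s)^2 |x|^2. *)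
Lemma scaled_dist_le (x y : C) (s : R) :
  Cmod y <= Cmod x -> 0 <= s <= 1 -> s * Cmod (x - y) <= Cmod (x - RtoC s * y).
Proof.
  intros Hxy Hs.
  apply Cmod_le_sqr in Hxy.
  apply pow2_le_reg; [apply Cmod_ge_0|].
  rewrite Rpow_mult_distr, !Cmod_sqr.
  destruct x as [x1 x2], y as [y1 y2]; simpl fst in *; simpl snd in *.
  assert (H : 2 * (x1 * y1 + x2 * y2) <= 2 * (x1 ^ 2 + x2 ^ 2)).
  { generalize (pow2_ge_0 (x1 - y1)) (pow2_ge_0 (x2 - y2)); lra. }
  assert (H1 : 0 <= s * (1 - s)) by nra.
  assert (H2 : 0 <= (1 - s) * (1 - s)) by nra.
  assert (H3 : 0 <= x1 ^ 2 + x2 ^ 2) by nra.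
  generalize (Rmult_le_pos _ _ H2 H3).
  generalize (Rmult_le_compat_l _ _ _ H1 H).
  lra.
Qed.

(** Each induction step leaves a remainder y^(n+1) s (x - y); [scaled_dist_le] trades s |x - y| for
    |x - s y|. *)
Lemma Cpow_scaled_le (x y : C) (s : R) (n : nat) :
  Cmod y <= Cmod x -> 0 <= s <= 1 ->
  Cmod (x ^ S n - RtoC s * y ^ S n)
  <= INR (S n) * Cmod x ^ n * Cmod (x - RtoC s * y).
Proof.
  intros Hxy Hs.
  induction n as [|n IH].
  - simpl; apply Req_le. rewrite !Cmult_1_r; ring.
  - replace (x ^ S (S n) - RtoC s * y ^ S (S n))%C
      with (x * (x ^ S n - RtoC s * y ^ S n) + y ^ S n * (RtoC s * (x - y)))%C
      by (simpl; ring).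
    eapply Rle_trans; [apply Cmod_triangle|].
    rewrite !(Cmod_mult x), (Cmod_mult (y ^ S n)), (Cmod_mult (RtoC s)), Cmod_pow, Cmod_R.
    rewrite (Rabs_pos_eq s) by lra.
    assert (H1 : Cmod y ^ S n <= Cmod x ^ S n)
      by (apply pow_incr; split; [apply Cmod_ge_0 | exact Hxy]).
    assert (H2 := Rmult_le_compat_l _ _ _ (Cmod_ge_0 x) IH).
    assert (H3 : Cmod y ^ S n * (s * Cmod (x - y)) <= Cmod x ^ S n * Cmod (x - RtoC s * y)).
    { apply Rmult_le_compat; [apply pow_le, Cmod_ge_0 | | exact H1 |].
      - apply Rmult_le_pos; [lra | apply Cmod_ge_0].
      - now apply scaled_dist_le. }
    rewrite (S_INR (S n)); simpl pow in *; lra.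
Qed.

(** Cauchy-Schwarz, by Lagrange's identity. *)
Lemma Cmod_inner_le (x y : C) :
  fst x * fst y + snd x * snd y <= Cmod x * Cmod y.
Proof.
  apply pow2_le_reg; [apply Rmult_le_pos; apply Cmod_ge_0|].
  rewrite Rpow_mult_distr, !Cmod_sqr.
  generalize (pow2_ge_0 (fst x * snd y - snd x * fst y)); lra.
Qed.

(* If |u|, |v| <= |z| then |z - u|^2 <= 2 Re (conj z (z - u)), and the right
   side is affine in u. *)
Lemma mean_dist2_le (z u v : C) (t : R) :
  Cmod u <= Cmod z -> Cmod v <= Cmod z -> 0 <= t <= 1 ->
  t * Cmod (z - u) ^ 2 + (1 - t) * Cmod (z - v) ^ 2
  <= 2 * Cmod z * Cmod (z - (RtoC t * u + RtoC (1 - t) * v)).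
Proof.
  intros Hu Hv Ht.
  apply Cmod_le_sqr in Hu; apply Cmod_le_sqr in Hv.
  assert (H := Cmod_inner_le z (z - (RtoC t * u + RtoC (1 - t) * v))).
  rewrite !Cmod_sqr.
  destruct z as [z1 z2], u as [u1 u2], v as [v1 v2].
  simpl fst in *; simpl snd in *.
  assert (H1 : 0 <= t * (z1 ^ 2 + z2 ^ 2 - (u1 ^ 2 + u2 ^ 2)))
    by (apply Rmult_le_pos; lra).
  assert (H2 : 0 <= (1 - t) * (z1 ^ 2 + z2 ^ 2 - (v1 ^ 2 + v2 ^ 2)))
    by (apply Rmult_le_pos; lra).
  lra.
Qed.

(** Expand at z to second order. With N = n + 1, the linear parts average to N z^(N-1) m. By
    [mean_dist2_le] the averaged quadratic remainders are at most N (N - 1) |z|^(N-1) |m|, and N + N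
    (N - 1) = N^2. *)
Lemma Cpow_mean_le (z u v : C) (t : R) (n : nat) :
  Cmod u <= Cmod z -> Cmod v <= Cmod z -> 0 <= t <= 1 ->
  Cmod (z ^ S n - (RtoC t * u ^ S n + RtoC (1 - t) * v ^ S n))
  <= INR (S n) ^ 2 * Cmod z ^ n * Cmod (z - (RtoC t * u + RtoC (1 - t) * v)).
Proof.
  intros Hu Hv Ht.
  set (m := (z - (RtoC t * u + RtoC (1 - t) * v))%C).
  destruct n as [|n].
  { simpl; rewrite !Cmult_1_r; fold m; apply Req_le; ring. }
  set (T w := (z ^ S (S n) - w ^ S (S n) - RtoC (INR (S (S n))) * z ^ S n * (z - w))%C).
  replace (z ^ S (S n) - (RtoC t * u ^ S (S n) + RtoC (1 - t) * v ^ S (S n)))%C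
    with (RtoC (INR (S (S n))) * z ^ S n * m + (RtoC t * T u + RtoC (1 - t) * T v))%C
    by (unfold m, T; rewrite RtoC_minus; ring).
  assert (Hm := mean_dist2_le z u v t Hu Hv Ht); fold m in Hm.
  assert (HTu := Cpow_taylor2_le z u (Cmod z) n (Rle_refl _) Hu); fold (T u) in HTu.
  assert (HTv := Cpow_taylor2_le z v (Cmod z) n (Rle_refl _) Hv); fold (T v) in HTv.
  eapply Rle_trans; [apply Cmod_triangle|].
  eapply Rle_trans; [apply Rplus_le_compat_l, Cmod_triangle|].
  rewrite !Cmod_mult, Cmod_pow, !Cmod_R, (Rabs_pos_eq _ (pos_INR _)),
    (Rabs_pos_eq t), (Rabs_pos_eq (1 - t)) by lra.
  set (K := INR (S n) * INR (S (S n)) / 2 * Cmod z ^ n) in *.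
  assert (HK : 0 <= K).
  { unfold K; repeat apply Rmult_le_pos; try apply pos_INR; try lra.
    apply pow_le, Cmod_ge_0. }
  assert (H1 := Rmult_le_compat_l t _ _ ltac:(lra) HTu).
  assert (H2 := Rmult_le_compat_l (1 - t) _ _ ltac:(lra) HTv).
  assert (H3 := Rmult_le_compat_l K _ _ HK Hm).
  replace (INR (S (S n)) ^ 2 * Cmod z ^ S n * Cmod m)
    with (INR (S (S n)) * Cmod z ^ S n * Cmod m + K * (2 * Cmod z * Cmod m)).
  - lra.
  - unfold K; rewrite (S_INR (S n)); change (Cmod z ^ S n) with (Cmod z * Cmod z ^ n); field.
Qed.

(** * Series of complex numbers *)

Lemma is_series_C_Series (u : nat -> C) (v : nat -> R) :
  (forall n, Cmod (u n) <= v n) -> ex_series v -> is_series u (C_Series u).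
Proof.
  intros Huv Hv.
  destruct (ex_series_le (K := C_AbsRing) (V := C_CompleteNormedModule) u v Huv Hv)
    as [l Hl].
  now rewrite (C_Series_unique u l Hl).
Qed.

Lemma Cmod_series_le (u : nat -> C) (v : nat -> R) (l : C) (s : R) :
  is_series u l -> is_series v s -> (forall n, Cmod (u n) <= v n) ->
  Cmod l <= s.
Proof.
  intros Hu Hv Huv.
  assert (H1 : is_lim_seq (fun n => Cmod (sum_n u n)) (Cmod l)).
  { unfold is_lim_seq.
    apply (filterlim_comp _ _ _ (sum_n u) Cmod eventually (locally (T := C_NormedModule) l)).
    - exact Hu.
    - exact (filterlim_norm (K := C_AbsRing) (V := C_NormedModule) l). }
  assert (H2 : is_lim_seq (sum_n v) s) by exact Hv.
  apply (is_lim_seq_le _ _ (Cmod l) s) with (2 := H1) (3 := H2).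
  intros n.
  eapply Rle_trans.
  - exact (norm_sum_n_m (K := C_AbsRing) (V := C_NormedModule) u 0 n).
  - now apply sum_n_m_le.
Qed.

Lemma Cmod_series_head (u : nat -> C) (v : nat -> R) (l : C) (s : R) :
  is_series u l -> is_series v s -> (forall n, Cmod (u (S n)) <= v n) ->
  Cmod (l - u 0%nat) <= s.
Proof.
  intros Hu Hv Huv.
  apply (Cmod_series_le (fun n => u (S n)) v); [| exact Hv | exact Huv].
  apply (is_series_incr_1 (K := C_AbsRing) (V := C_NormedModule)).
  match goal with |- is_series _ ?x => replace x with l; [exact Hu|] end.
  symmetry; change (((l - u 0%nat) + u 0%nat)%C = l); ring.
Qed.

(** * Local inversion and lifting of segments *)

Fixpoint iterate (Phi : C -> C) (x0 : C) (n : nat) : C :=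
  match n with O => x0 | S n => Phi (iterate Phi x0 n) end.

(* Banach's fixed point theorem for [x |-> w - (f x - x)]. *)
Lemma locally_surjective (f : C -> C) (z0 w : C) (delta L : R) :
  0 <= delta -> 0 <= L < 1 ->
  (forall x y, Cmod (x - z0) <= delta -> Cmod (y - z0) <= delta ->
     Cmod (f x - f y - (x - y)) <= L * Cmod (x - y)) ->
  Cmod (w - f z0) <= (1 - L) * delta ->
  exists z, Cmod (z - z0) <= delta /\ f z = w.
Proof.
  intros Hd HL Hf Hw.
  set (Phi := fun x => (w - (f x - x))%C).
  assert (Hself : forall x, Cmod (x - z0) <= delta -> Cmod (Phi x - z0) <= delta).
  { intros x Hx.
    replace (Phi x - z0)%C with ((w - f z0) - (f x - f z0 - (x - z0)))%C
      by (unfold Phi; ring).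
    eapply Rle_trans; [apply Cmod_triangle_minus|].
    assert (H0 : Cmod (z0 - z0) <= delta)
      by (replace (z0 - z0)%C with (RtoC 0) by ring; now rewrite Cmod_0).
    assert (H := Hf x z0 Hx H0).
    assert (H1 := Rmult_le_compat_l L _ _ (proj1 HL) Hx).
    lra. }
  assert (Hcontr : forall x y, Cmod (x - z0) <= delta -> Cmod (y - z0) <= delta ->
                     Cmod (Phi x - Phi y) <= L * Cmod (x - y)).
  { intros x y Hx Hy.
    replace (Phi x - Phi y)%C with (- (f x - f y - (x - y)))%C by (unfold Phi; ring).
    rewrite Cmod_opp; now apply Hf. }
  set (X := iterate Phi z0).
  assert (HX : forall n, Cmod (X n - z0) <= delta).
  { induction n as [|n IH].
    - change (X 0%nat) with z0.
      replace (z0 - z0)%C with (RtoC 0) by ring; now rewrite Cmod_0.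
    - now apply Hself. }
  (* The limit of the iterates is z0 plus the sum of their increments. A geometric series with sum
     exactly [delta] dominates these, so the limit stays in the disk. *)
  set (u := fun n => (X (S n) - X n)%C).
  assert (Hu : forall n, Cmod (u n) <= (1 - L) * delta * L ^ n).
  { induction n as [|n IH].
    - change (u 0%nat) with (w - (f z0 - z0) - z0)%C.
      replace (w - (f z0 - z0) - z0)%C with (w - f z0)%C by ring.
      simpl; lra.
    - unfold u. change (X (S (S n))) with (Phi (X (S n))).
      change (X (S n)) with (Phi (X n)) at 2.
      eapply Rle_trans; [apply Hcontr; apply HX|].
      fold (u n). assert (H := Rmult_le_compat_l L _ _ (proj1 HL) IH).
      simpl; lra. }
  assert (Hgeom : is_series (fun n => (1 - L) * delta * L ^ n) delta).
  { assert (Hg : is_series (fun n => L ^ n) (/ (1 - L)))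
      by (apply is_series_geom; rewrite Rabs_pos_eq; lra).
    assert (Hg' : is_series (fun n => (1 - L) * delta * L ^ n)
                    ((1 - L) * delta * / (1 - L)))
      by exact (is_series_scal_l (K := R_AbsRing) (V := R_NormedModule) _ _ _ Hg).
    replace ((1 - L) * delta * / (1 - L)) with delta in Hg' by (field; lra).
    exact Hg'. }
  assert (Hl := is_series_C_Series _ _ Hu (ex_intro _ _ Hgeom)).
  set (l := C_Series u) in *.
  exists (z0 + l)%C.
  assert (Hz : Cmod (z0 + l - z0) <= delta).
  { replace (z0 + l - z0)%C with l by ring.
    exact (Cmod_series_le _ _ _ _ Hl Hgeom Hu). }
  split; [exact Hz|].
  assert (Hsum : forall n, sum_n u n = (X (S n) - z0)%C).
  { induction n as [|n IH].
    - now rewrite sum_O.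
    - rewrite sum_Sn, IH. change (X (S n) - z0 + (X (S (S n)) - X (S n)) = X (S (S n)) - z0)%C.
      ring. }
  assert (Hlim : forall eps : posreal, exists N, forall n, (N <= n)%nat ->
                   Cmod (X (S n) - (z0 + l)) < eps).
  { intros eps.
    destruct (Hl (ball_norm (K := C_AbsRing) (V := C_NormedModule) l eps)) as [N HN].
    - apply locally_ball_norm.
    - exists N; intros n Hn; specialize (HN n Hn).
      unfold ball_norm in HN. rewrite Hsum in HN.
      replace (X (S n) - (z0 + l))%C with (X (S n) - z0 - l)%C by ring.
      exact HN. }
  (* For the limit z, w - f z = Phi z - z; comparison with [Phi (X (S N))], which is close to both z
     and Phi z, makes this arbitrarily small. *)
  symmetry; apply Ceq_minus, Cmod_le_0.
  apply Rle_plus_epsilon; intros eps Heps; rewrite Rplus_0_l.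
  destruct (Hlim (mkposreal (eps / 2) ltac:(lra))) as [N HN]; simpl in HN.
  assert (H1 := HN N (Nat.le_refl _)); assert (H2 := HN (S N) ltac:(lia)).
  change (X (S (S N))) with (Phi (X (S N))) in H2.
  assert (H3 := Hcontr _ _ (HX (S N)) Hz).
  replace (w - f (z0 + l))%C with
    ((Phi (X (S N)) - (z0 + l)) - (Phi (X (S N)) - Phi (z0 + l)))%C
    by (unfold Phi at 3; ring).
  eapply Rle_trans; [apply Cmod_triangle_minus|].
  assert (H4 : L * Cmod (X (S N) - (z0 + l)) <= 1 * Cmod (X (S N) - (z0 + l)))
    by (apply Rmult_le_compat_r; [apply Cmod_ge_0 | lra]).
  lra.
Qed.

(* Lifts the segment in finitely many steps, each of a size to which
   [locally_surjective] applies with one and the same radius [rho' - rho]. *)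
Lemma segment_lift (f : C -> C) (rho rho' L : R) (w0 w1 z0 : C) :
  rho < rho' -> 0 <= L < 1 ->
  (forall x y, Cmod x <= rho' -> Cmod y <= rho' ->
     Cmod (f x - f y - (x - y)) <= L * Cmod (x - y)) ->
  Cmod z0 <= rho -> f z0 = w0 ->
  (forall z t, 0 <= t <= 1 -> Cmod z <= rho' ->
     f z = (w0 + RtoC t * (w1 - w0))%C -> Cmod z <= rho) ->
  forall t, 0 <= t <= 1 ->
  exists z, Cmod z <= rho /\ f z = (w0 + RtoC t * (w1 - w0))%C.
Proof.
  intros Hrho HL Hf Hz0 Hfz0 Hstay t Ht.
  (* The step length that [locally_surjective] permits for the radius rho' - rho; disks of this
     radius about points with |z| <= rho stay where [Hf] applies. *)
  set (eta := (1 - L) * (rho' - rho)).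
  assert (Heta : 0 < eta) by (apply Rmult_lt_0_compat; lra).
  destruct (INR_unbounded (Cmod (w1 - w0) / eta)) as [N HN].
  assert (HN0 : 0 < INR N).
  { eapply Rle_lt_trans; [|exact HN].
    apply Rdiv_le_0_compat; [apply Cmod_ge_0 | exact Heta]. }
  assert (Hstep : / INR N * Cmod (w1 - w0) <= eta).
  { apply Rmult_le_reg_l with (INR N); [exact HN0|].
    rewrite <- Rmult_assoc, Rinv_r, Rmult_1_l by lra.
    apply (Rmult_lt_compat_r eta) in HN; [|exact Heta].
    unfold Rdiv in HN; rewrite Rmult_assoc, Rinv_l, Rmult_1_r in HN; lra. }
  assert (H : forall k, (k <= N)%nat ->
     exists z, Cmod z <= rho /\ f z = (w0 + RtoC (t * (INR k / INR N)) * (w1 - w0))%C).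
  { induction k as [|k IH]; intros Hk.
    - exists z0; split; [exact Hz0|]. rewrite Hfz0.
      replace (t * (INR 0 / INR N)) with 0 by (simpl; field; lra). ring.
    - destruct IH as [z [Hz Hfz]]; [lia|].
      set (t' := t * (INR (S k) / INR N)).
      assert (Ht' : 0 <= t' <= 1).
      { assert (H0 : 0 <= INR (S k) / INR N <= 1).
        { split; [apply Rdiv_le_0_compat; [apply pos_INR | exact HN0]|].
          apply Rle_div_l; [exact HN0|]. rewrite Rmult_1_l. now apply le_INR. }
        unfold t'; split; [nra|].
        replace 1 with (1 * 1) by ring; apply Rmult_le_compat; lra. }
      destruct (locally_surjective f z (w0 + RtoC t' * (w1 - w0)) (rho' - rho) L)
        as [z' [Hz' Hfz']].
      + lra.
      + exact HL.
      + assert (Hin : forall x, Cmod (x - z) <= rho' - rho -> Cmod x <= rho').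
        { intros x Hx. replace x with ((x - z) + z)%C by ring.
          eapply Rle_trans; [apply Cmod_triangle | lra]. }
        intros x y Hx Hy; apply Hf; now apply Hin.
      + rewrite Hfz.
        replace (w0 + RtoC t' * (w1 - w0)
                 - (w0 + RtoC (t * (INR k / INR N)) * (w1 - w0)))%C
          with (RtoC (t * / INR N) * (w1 - w0))%C.
        * rewrite Cmod_mult, Cmod_R, Rabs_pos_eq.
          -- eapply Rle_trans; [|exact Hstep].
             apply Rmult_le_compat_r; [apply Cmod_ge_0|].
             assert (0 < / INR N) by now apply Rinv_0_lt_compat. nra.
          -- assert (0 < / INR N) by now apply Rinv_0_lt_compat. nra.
        * replace (t * / INR N) with (t' - t * (INR k / INR N)).
          -- rewrite RtoC_minus; ring.
          -- unfold t'; rewrite S_INR; field; lra.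
      (* A priori z' only satisfies |z'| <= rho'; [Hstay] brings it back to |z'| <= rho, so the step
         length never shrinks. *)
      + exists z'; split; [|exact Hfz'].
        apply (Hstay z' t'); [exact Ht' | | exact Hfz'].
        replace z' with ((z' - z) + z)%C by ring.
        eapply Rle_trans; [apply Cmod_triangle | lra]. }
  destruct (H N (Nat.le_refl _)) as [z Hz].
  exists z. replace t with (t * (INR N / INR N)) by (field; lra). exact Hz.
Qed.

Lemma open_image (f : C -> C) (r L : R) :
  0 <= L < 1 ->
  (forall x y, Cdisk r x -> Cdisk r y ->
     Cmod (f x - f y - (x - y)) <= L * Cmod (x - y)) ->
  open (image f (Cdisk r)).
Proof.
  intros HL Hf w [z0 [Hz0 Hfz0]]; unfold Cdisk in *.
  (* Half the distance to the boundary circle, so that the closed disk of this radius lies inside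
     the open one. *)
  set (delta := (r - Cmod z0) / 2).
  assert (Hd : 0 < delta) by (unfold delta; lra).
  assert (Hin : forall x, Cmod (x - z0) <= delta -> Cmod x < r).
  { intros x Hx. replace x with ((x - z0) + z0)%C by ring.
    eapply Rle_lt_trans; [apply Cmod_triangle | unfold delta in *; lra]. }
  assert (He : 0 < (1 - L) * delta) by (apply Rmult_lt_0_compat; lra).
  apply (locally_le_locally_norm (K := C_AbsRing) (V := C_NormedModule) w).
  exists (mkposreal _ He); intros w' Hw'; simpl in Hw'.
  destruct (locally_surjective f z0 w' delta L) as [z [Hz Hfz]].
  - lra.
  - exact HL.
  - intros x y Hx Hy; apply Hf; now apply Hin.
  - rewrite Hfz0; apply Rlt_le; exact Hw'.
  - exists z; split; [now apply Hin | exact Hfz].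
Qed.

(** * Power series with small coefficients *)

(** The exponent is written [k + 1], as in [wright], to make the Wright function convertible to an
    instance. *)
Definition power_sum (d : nat -> C) (z : C) : C :=
  C_Series (fun k => (d k * z ^ (k + 1))%C).

Lemma is_series_scal_C (c : C) (u : nat -> C) (l : C) :
  is_series u l -> is_series (fun k => (c * u k)%C) (c * l)%C.
Proof. exact (is_series_scal_l (K := C_AbsRing) (V := C_NormedModule) c u l). Qed.

Lemma is_series_plus_C (u v : nat -> C) (l m : C) :
  is_series u l -> is_series v m -> is_series (fun k => (u k + v k)%C) (l + m)%C.
Proof. exact (is_series_plus (K := C_AbsRing) (V := C_NormedModule) u v l m). Qed.

Lemma is_series_minus_C (u v : nat -> C) (l m : C) :
  is_series u l -> is_series v m -> is_series (fun k => (u k - v k)%C) (l - m)%C.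
Proof. exact (is_series_minus (K := C_AbsRing) (V := C_NormedModule) u v l m). Qed.

Lemma is_series_ext_C (u v : nat -> C) (l : C) :
  (forall k, u k = v k) -> is_series u l -> is_series v l.
Proof. exact (is_series_ext (K := C_AbsRing) (V := C_NormedModule) u v l). Qed.

Lemma is_series_scal_R (c : R) (u : nat -> R) (l : R) :
  is_series u l -> is_series (fun k => c * u k) (c * l).
Proof. exact (is_series_scal_l (K := R_AbsRing) (V := R_NormedModule) c u l). Qed.

Lemma ex_series_le_R (u v : nat -> R) :
  (forall k, 0 <= u k <= v k) -> ex_series v -> ex_series u.
Proof.
  intros Huv.
  apply (ex_series_le (K := R_AbsRing) (V := R_CompleteNormedModule)).
  intros k; change (Rabs (u k) <= v k); rewrite Rabs_pos_eq; apply Huv.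
Qed.

Lemma is_series_ge_0 (v : nat -> R) (s : R) :
  is_series v s -> (forall k, 0 <= v k) -> 0 <= s.
Proof.
  intros Hv Hpos.
  apply (is_lim_seq_le (fun _ => 0) (sum_n v) 0 s).
  - intros n; rewrite sum_n_Reals; now apply cond_pos_sum.
  - apply is_lim_seq_const.
  - exact Hv.
Qed.

Lemma pow_le_1 (r : R) (n : nat) : 0 <= r <= 1 -> r ^ n <= 1.
Proof. intros H; rewrite <- (pow1 n); now apply pow_incr. Qed.

Lemma pow_S_le (r : R) (n : nat) : 0 <= r <= 1 -> r ^ S n <= r.
Proof.
  intros H; assert (H1 := pow_le_1 r n H); simpl; nra.
Qed.

Lemma INR_S_ge_1 (k : nat) : 1 <= INR (S k).
Proof. rewrite S_INR; generalize (pos_INR k); lra. Qed.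

Lemma weight_le (k : nat) (c r : R) :
  0 <= c -> 0 <= r <= 1 -> INR (S k) * c * r ^ k <= INR (S k) ^ 2 * c.
Proof.
  intros Hc Hr.
  assert (H1 := pow_le_1 r k Hr).
  assert (H3 := INR_S_ge_1 k).
  set (i := INR (S k)) in *; clearbody i.
  assert (H4 : 0 <= i * c) by (apply Rmult_le_pos; lra).
  assert (H5 := Rmult_le_compat_l _ _ _ H4 H1).
  assert (H6 := Rmult_le_compat_r _ _ _ H4 H3).
  lra.
Qed.

Lemma is_series_power_sum (d : nat -> C) (z : C) :
  ex_series (fun k => INR (S k) ^ 2 * Cmod (d k)) -> Cmod z <= 1 ->
  is_series (fun k => (d k * z ^ S k)%C) (power_sum d z).
Proof.
  intros Hd Hz.
  apply is_series_ext_C with (fun k => (d k * z ^ (k + 1))%C);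
    [intros k; now rewrite Nat.add_1_r|].
  apply is_series_C_Series with (v := fun k => INR (S k) ^ 2 * Cmod (d k));
    [|exact Hd].
  intros k; rewrite Cmod_mult, Cmod_pow, Rmult_comm.
  apply Rmult_le_compat_r; [apply Cmod_ge_0|].
  apply Rle_trans with 1.
  - apply pow_le_1; split; [apply Cmod_ge_0 | exact Hz].
  - generalize (INR_S_ge_1 k); nra.
Qed.

(** Termwise differentiation: [Cpow_taylor2_le] on the closed unit disk bounds the remainder of each
    term, and summation gives a total remainder of at most K |y - z|^2, where K is the sum of the
    quadratically weighted coefficients. *)
Lemma power_sum_derive (d : nat -> C) (z : C) :
  ex_series (fun k => INR (S k) ^ 2 * Cmod (d k)) -> Cmod z < 1 ->
  is_derive (K := C_AbsRing) (V := C_NormedModule) (power_sum d) z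
    (C_Series (fun k => (RtoC (INR (S k)) * d k * z ^ k)%C)).
Proof.
  intros Hd Hz.
  set (D := C_Series _).
  assert (HD : is_series (fun k => (RtoC (INR (S k)) * d k * z ^ k)%C) D).
  { apply is_series_C_Series with (v := fun k => INR (S k) ^ 2 * Cmod (d k));
      [|exact Hd].
    intros k; rewrite !Cmod_mult, Cmod_R, (Rabs_pos_eq _ (pos_INR _)), Cmod_pow.
    apply weight_le; [apply Cmod_ge_0 | split; [apply Cmod_ge_0 | lra]]. }
  assert (Hd' := Hd); destruct Hd' as [K HK].
  assert (HK0 : 0 <= K).
  { apply (is_series_ge_0 _ _ HK); intros k.
    apply Rmult_le_pos; [apply pow2_ge_0 | apply Cmod_ge_0]. }
  assert (Hquad : forall y, Cmod y <= 1 ->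
            Cmod (power_sum d y - power_sum d z - (y - z) * D) <= Cmod (y - z) ^ 2 * K).
  { intros y Hy.
    apply (Cmod_series_le
             (fun k => (d k * y ^ S k - d k * z ^ S k
                        - (y - z) * (RtoC (INR (S k)) * d k * z ^ k))%C)
             (fun k => Cmod (y - z) ^ 2 * (INR (S k) ^ 2 * Cmod (d k)))).
    - apply is_series_minus_C; [apply is_series_minus_C|].
      + now apply is_series_power_sum.
      + apply is_series_power_sum; [exact Hd | lra].
      + now apply is_series_scal_C.
    - now apply is_series_scal_R.
    - intros [|n].
      + change (INR 1) with 1.
        replace (d 0%nat * y ^ 1 - d 0%nat * z ^ 1
                 - (y - z) * (RtoC 1 * d 0%nat * z ^ 0))%C
          with (RtoC 0) by (simpl; ring).
        rewrite Cmod_0; repeat apply Rmult_le_pos; try apply pow2_ge_0; try lra;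
          apply Cmod_ge_0.
      + replace (d (S n) * y ^ S (S n) - d (S n) * z ^ S (S n)
                 - (y - z) * (RtoC (INR (S (S n))) * d (S n) * z ^ S n))%C
          with (- (d (S n) * (z ^ S (S n) - y ^ S (S n)
                   - RtoC (INR (S (S n))) * z ^ S n * (z - y))))%C by ring.
        rewrite Cmod_opp, Cmod_mult.
        assert (H := Cpow_taylor2_le z y 1 n (Rlt_le _ _ Hz) Hy).
        rewrite pow1, (Cmod_minus_sym z y) in H.
        assert (H1 : INR (S n) * INR (S (S n)) / 2 <= INR (S (S n)) ^ 2)
          by (generalize (INR_S_ge_1 n); rewrite (S_INR (S n)); nra).
        assert (H2 := Rmult_le_compat_r _ _ _ (pow2_ge_0 (Cmod (y - z))) H1).
        assert (H3 := Rmult_le_compat_l _ _ _ (Cmod_ge_0 (d (S n)))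
                        (Rle_trans _ _ _ H ltac:(rewrite Rmult_1_r; exact H2))).
        lra. }
  split; [apply is_linear_scal_l|].
  intros x Hx.
  apply (is_filter_lim_locally_unique (K := C_AbsRing)
           (V := AbsRing_NormedModule C_AbsRing)) in Hx.
  subst x; intros eps.
  (* K + 1 instead of K, because K is only known to be nonnegative. The other bound, 1 - |z|, keeps
     y in the unit disk. *)
  assert (Heps : 0 < eps / (K + 1)) by (apply Rdiv_lt_0_compat; [apply eps | lra]).
  assert (Hpos : 0 < Rmin (1 - Cmod z) (eps / (K + 1)))
    by (apply Rmin_glb_lt; lra).
  exists (mkposreal _ Hpos); intros y Hy.
  change (Cmod (y - z) < Rmin (1 - Cmod z) (eps / (K + 1))) in Hy.
  change (Cmod (power_sum d y - power_sum d z - (y - z) * D) <= eps * Cmod (y - z)).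
  assert (Hy1 := Rlt_le_trans _ _ _ Hy (Rmin_l _ _)).
  assert (Hy2 := Rlt_le_trans _ _ _ Hy (Rmin_r _ _)).
  eapply Rle_trans; [apply Hquad|].
  - replace y with ((y - z) + z)%C by ring.
    eapply Rle_trans; [apply Cmod_triangle | lra].
  - apply Rlt_le in Hy2; apply Rle_div_r in Hy2; [|lra].
    assert (H := Rmult_le_compat_r _ _ _ (Cmod_ge_0 (y - z)) Hy2).
    assert (H1 := pow2_ge_0 (Cmod (y - z))).
    nra.
Qed.

(** Common frame of the three estimates below: X k is a fixed linear combination of (k+1)-st powers,
    so [X 0] is the same combination of the points themselves, and the rest of the series is an
    error of size q s. *)
Lemma weighted_series_head (d X : nat -> C) (l : C) (q s : R) :
  d 0%nat = RtoC 1 -> is_series (fun k => INR (S (S k)) * Cmod (d (S k))) s ->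
  is_series (fun k => (d k * X k)%C) l ->
  (forall k, Cmod (X (S k)) <= INR (S (S k)) * q) ->
  Cmod (l - X 0%nat) <= q * s.
Proof.
  intros Hd0 Hs Hl HX.
  replace (X 0%nat) with (d 0%nat * X 0%nat)%C by (rewrite Hd0; ring).
  apply (Cmod_series_head (fun k => (d k * X k)%C)
           (fun k => q * (INR (S (S k)) * Cmod (d (S k))))).
  - exact Hl.
  - now apply is_series_scal_R.
  - intros k; rewrite Cmod_mult.
    assert (H := Rmult_le_compat_l _ _ _ (Cmod_ge_0 (d (S k))) (HX k)). lra.
Qed.

(** Here the radius 1/2 of the convexity claim enters. *)
Lemma INR_le_pow2 (k : nat) : INR (S (S k)) * (1 / 2) ^ S k <= 1.
Proof.
  induction k as [|k IH]; [simpl; lra|].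
  rewrite (S_INR (S (S k))).
  change ((1 / 2) ^ S (S k)) with (1 / 2 * (1 / 2) ^ S k).
  assert (H := pow_lt (1 / 2) (S k) ltac:(lra)).
  assert (H1 := INR_S_ge_1 (S k)).
  nra.
Qed.

(** When a combination of values vanishes, the estimates below take this form, and the same
    combination of the points must vanish too. *)
Lemma Cmod_contract_0 (c : C) (q : R) : q < 1 -> Cmod (0 - c) <= q * Cmod c -> c = RtoC 0.
Proof.
  intros Hq H; apply Cmod_le_0.
  replace (0 - c)%C with (- c)%C in H by ring; rewrite Cmod_opp in H.
  generalize (Cmod_ge_0 c); nra.
Qed.

(** * Near-identity estimates for power sums *)

Section PowerSum.

Context (d : nat -> C) (s : R).
Context (d0 : d 0%nat = RtoC 1).
Context (ds : is_series (fun k => INR (S (S k)) * Cmod (d (S k))) s).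
Context (d2 : ex_series (fun k => INR (S k) ^ 2 * Cmod (d k))).

(** Of the factor r^(k+1) in [Cpow_diff_le] one r is kept and the rest bounded by 1. The resulting
    constant r s is below 1 for r < 1 even if s = 1. *)
Lemma power_sum_near_id (x y : C) (r : R) :
  r <= 1 -> Cmod x <= r -> Cmod y <= r ->
  Cmod (power_sum d x - power_sum d y - (x - y)) <= r * s * Cmod (x - y).
Proof.
  intros Hr Hx Hy.
  assert (Hr0 := Rle_trans _ _ _ (Cmod_ge_0 x) Hx).
  replace (x - y)%C with (x ^ 1 - y ^ 1)%C at 1 by (simpl; ring).
  replace (r * s * Cmod (x - y)) with (r * Cmod (x - y) * s) by ring.
  apply (weighted_series_head d (fun k => x ^ S k - y ^ S k)%C); auto.
  - apply is_series_ext_C with (fun k => d k * x ^ S k - d k * y ^ S k)%C;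
      [intros; ring|].
    apply is_series_minus_C; apply is_series_power_sum; auto; lra.
  - intros k.
    eapply Rle_trans; [apply (Cpow_diff_le x y r); assumption|].
    rewrite Rmult_assoc; apply Rmult_le_compat_l; [apply pos_INR|].
    apply Rmult_le_compat_r; [apply Cmod_ge_0|].
    apply pow_S_le; lra.
Qed.

Lemma power_sum_scaled (x y : C) (t : R) :
  Cmod y <= Cmod x -> Cmod x <= 1 -> 0 <= t <= 1 ->
  Cmod (power_sum d x - RtoC t * power_sum d y - (x - RtoC t * y))
  <= Cmod x * s * Cmod (x - RtoC t * y).
Proof.
  intros Hyx Hx Ht.
  replace (x - RtoC t * y)%C with (x ^ 1 - RtoC t * y ^ 1)%C at 1 by (simpl; ring).
  replace (Cmod x * s * Cmod (x - RtoC t * y))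
    with (Cmod x * Cmod (x - RtoC t * y) * s) by ring.
  apply (weighted_series_head d (fun k => x ^ S k - RtoC t * y ^ S k)%C); auto.
  - apply is_series_ext_C with (fun k => d k * x ^ S k - RtoC t * (d k * y ^ S k))%C;
      [intros; ring|].
    apply is_series_minus_C; [|apply is_series_scal_C];
      apply is_series_power_sum; auto; lra.
  - intros k.
    eapply Rle_trans; [apply Cpow_scaled_le; assumption|].
    rewrite Rmult_assoc; apply Rmult_le_compat_l; [apply pos_INR|].
    apply Rmult_le_compat_r; [apply Cmod_ge_0|].
    apply pow_S_le; split; [apply Cmod_ge_0 | exact Hx].
Qed.

(* On |z| <= 1/2 the quadratic weights (k + 2)^2 |z|^(k+1) of [Cpow_mean_le] are
   at most 2 |z| (k + 2), so the linear weights suffice here as well. *)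
Lemma power_sum_mean (z u v : C) (t : R) :
  Cmod u <= Cmod z -> Cmod v <= Cmod z -> Cmod z <= 1 / 2 -> 0 <= t <= 1 ->
  Cmod (power_sum d z - (RtoC t * power_sum d u + RtoC (1 - t) * power_sum d v)
        - (z - (RtoC t * u + RtoC (1 - t) * v)))
  <= 2 * Cmod z * s * Cmod (z - (RtoC t * u + RtoC (1 - t) * v)).
Proof.
  intros Hu Hv Hz Ht.
  set (m := (z - (RtoC t * u + RtoC (1 - t) * v))%C).
  replace m with (z ^ 1 - (RtoC t * u ^ 1 + RtoC (1 - t) * v ^ 1))%C at 1
    by (unfold m; simpl; ring).
  replace (2 * Cmod z * s * Cmod m) with (2 * Cmod z * Cmod m * s) by ring.
  apply (weighted_series_head d
           (fun k => z ^ S k - (RtoC t * u ^ S k + RtoC (1 - t) * v ^ S k))%C); auto.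
  - apply is_series_ext_C with
      (fun k => d k * z ^ S k
                - (RtoC t * (d k * u ^ S k) + RtoC (1 - t) * (d k * v ^ S k)))%C;
      [intros; ring|].
    apply is_series_minus_C; [|apply is_series_plus_C; apply is_series_scal_C];
      apply is_series_power_sum; auto; lra.
  - intros k.
    eapply Rle_trans; [apply Cpow_mean_le; assumption|]. fold m.
    replace (INR (S (S k)) ^ 2 * Cmod z ^ S k * Cmod m)
      with (INR (S (S k)) * (INR (S (S k)) * Cmod z ^ S k * Cmod m)) by ring.
    apply Rmult_le_compat_l; [apply pos_INR|].
    apply Rmult_le_compat_r; [apply Cmod_ge_0|].
    assert (H := INR_le_pow2 k).
    assert (H1 : Cmod z ^ k <= (1 / 2) ^ k)
      by (apply pow_incr; split; [apply Cmod_ge_0 | exact Hz]).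
    change ((1 / 2) ^ S k) with (1 / 2 * (1 / 2) ^ k) in H.
    change (Cmod z ^ S k) with (Cmod z * Cmod z ^ k).
    assert (H2 := Rmult_le_compat_l _ _ _ (pos_INR (S (S k))) H1).
    assert (H3 : INR (S (S k)) * Cmod z ^ k <= 2) by lra.
    assert (H4 := Rmult_le_compat_l _ _ _ (Cmod_ge_0 z) H3).
    lra.
Qed.

(** * Univalence, starlikeness and convexity when the weighted sum is at most 1 *)

Context (s1 : s <= 1).

Lemma weight_sum_ge_0 : 0 <= s.
Proof.
  apply (is_series_ge_0 _ _ ds); intros k.
  apply Rmult_le_pos; [apply pos_INR | apply Cmod_ge_0].
Qed.

Lemma power_sum_0 : power_sum d (RtoC 0) = RtoC 0.
Proof.
  apply C_Series_unique.
  (* The zero series is obtained as 0 times the convergent series at z = 1. *)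
  assert (H : is_series (fun k => d k * RtoC 1 ^ S k)%C (power_sum d (RtoC 1)))
    by (apply is_series_power_sum; [exact d2 | rewrite Cmod_1; lra]).
  apply (is_series_scal_C (RtoC 0)) in H.
  rewrite Cmult_0_l in H.
  revert H; apply is_series_ext_C; intros k; rewrite Nat.add_1_r; simpl; ring.
Qed.

Lemma power_sum_derive_0 :
  is_derive (K := C_AbsRing) (V := C_NormedModule) (power_sum d) (RtoC 0) (RtoC 1).
Proof.
  replace (RtoC 1) with (C_Series (fun k => (RtoC (INR (S k)) * d k * RtoC 0 ^ k)%C)).
  - apply power_sum_derive; [exact d2 | rewrite Cmod_0; lra].
  - apply Ceq_minus, Cmod_le_0.
    replace (RtoC 1) with (RtoC (INR 1) * d 0%nat * RtoC 0 ^ 0)%C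
      by (rewrite d0; simpl; ring).
    apply Rle_trans with (0 * s); [|lra].
    apply (Cmod_series_head (fun k => (RtoC (INR (S k)) * d k * RtoC 0 ^ k)%C)
             (fun k => 0 * (INR (S (S k)) * Cmod (d (S k))))).
    + apply is_series_C_Series with (v := fun k => INR (S k) ^ 2 * Cmod (d k));
        [|exact d2].
      intros k; rewrite !Cmod_mult, Cmod_R, (Rabs_pos_eq _ (pos_INR _)), Cmod_pow, Cmod_0.
      apply weight_le; [apply Cmod_ge_0 | lra].
    + now apply is_series_scal_R.
    + intros k; rewrite !Cmod_mult, Cmod_pow, Cmod_0; simpl pow; lra.
Qed.

Lemma power_sum_normalized (r : R) : r <= 1 -> normalized r (power_sum d).
Proof.
  intros Hr; split; [|split].
  - intros z Hz; eexists; apply power_sum_derive; [exact d2 | unfold Cdisk in Hz; lra].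
  - exact power_sum_0.
  - exact power_sum_derive_0.
Qed.

Lemma power_sum_univalent (r : R) : r <= 1 -> univalent_on (Cdisk r) (power_sum d).
Proof.
  intros Hr; split; [apply (power_sum_normalized r Hr)|].
  intros z1 z2 H1 H2 He; unfold Cdisk in *.
  apply Ceq_minus.
  (* As s = 1 is possible, the strict contraction has to come from q < 1. *)
  set (q := Rmax (Cmod z1) (Cmod z2)).
  assert (Hq : q < 1) by (unfold q; apply Rmax_lub_lt; lra).
  assert (Hq0 : 0 <= q) by (eapply Rle_trans; [apply (Cmod_ge_0 z1) | apply Rmax_l]).
  assert (Hs := weight_sum_ge_0).
  apply (Cmod_contract_0 _ (q * s)); [nra|].
  assert (H := power_sum_near_id z1 z2 q (Rlt_le _ _ Hq) (Rmax_l _ _) (Rmax_r _ _)).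
  rewrite He in H.
  now replace (power_sum d z2 - power_sum d z2)%C with (RtoC 0) in H by ring.
Qed.

Lemma power_sum_starlike : starlike_in 1 (power_sum d).
Proof.
  split; [apply power_sum_normalized; lra|].
  split; [apply power_sum_univalent; lra|].
  intros w t [z0 [Hz0 Hw]] Ht; unfold Cdisk in Hz0.
  assert (Hs := weight_sum_ge_0).
  assert (Hz0' := Cmod_ge_0 z0).
  set (rho' := (Cmod z0 + 1) / 2).
  (* The segment runs from w to 0, so the point t w has parameter 1 - t. *)
  destruct (segment_lift (power_sum d) (Cmod z0) rho' (rho' * s) w (RtoC 0) z0)
    with (t := 1 - t) as [z [Hz Hfz]].
  - unfold rho'; lra.
  - unfold rho'; nra.
  - intros x y; apply power_sum_near_id; unfold rho'; lra.
  - lra.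
  - exact Hw.
  - intros z t' Ht' Hz Hfz.
    (* If |z| > |z0|, then f z = (1 - t') f z0 and [power_sum_scaled] force z = (1 - t') z0, whose
       modulus is at most |z0|. *)
    apply Rnot_lt_le; intros Hlt.
    assert (Hz1 : Cmod z < 1) by (unfold rho' in Hz; lra).
    assert (Hc : (z - RtoC (1 - t') * z0)%C = RtoC 0).
    { apply (Cmod_contract_0 _ (Cmod z * s)); [nra|].
      assert (H := power_sum_scaled z z0 (1 - t') (Rlt_le _ _ Hlt) (Rlt_le _ _ Hz1) ltac:(lra)).
      replace (power_sum d z - RtoC (1 - t') * power_sum d z0)%C with (RtoC 0) in H;
        [exact H|].
      rewrite Hfz, Hw, RtoC_minus; ring. }
    apply Ceq_minus in Hc.
    rewrite Hc, Cmod_mult, Cmod_R, Rabs_pos_eq in Hlt by lra.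
    nra.
  - lra.
  - exists z; split; [unfold Cdisk; lra|].
    rewrite Hfz, RtoC_minus; ring.
Qed.

Lemma power_sum_convex : convex_in (1 / 2) (power_sum d).
Proof.
  assert (Hs := weight_sum_ge_0).
  split; [apply power_sum_normalized; lra|].
  split; [apply power_sum_univalent; lra|].
  split; [|split].
  - exists (power_sum d (RtoC 0)), (RtoC 0); split; [|reflexivity].
    unfold Cdisk; rewrite Cmod_0; lra.
  - apply (open_image _ _ (1 / 2 * s)); [lra|].
    intros x y Hx Hy; unfold Cdisk in *; apply power_sum_near_id; lra.
  - intros w1 w2 t [z1 [Hz1 Hw1]] [z2 [Hz2 Hw2]] Ht; unfold Cdisk in *.
    set (rho := Rmax (Cmod z1) (Cmod z2)).
    assert (Hrho : 0 <= rho < 1 / 2).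
    { split; [eapply Rle_trans; [apply (Cmod_ge_0 z1) | apply Rmax_l]|].
      now apply Rmax_lub_lt. }
    set (rho' := (rho + 1 / 2) / 2).
    destruct (segment_lift (power_sum d) rho rho' (rho' * s) w2 w1 z2)
      with (t := t) as [z [Hz Hfz]].
    + unfold rho'; lra.
    + unfold rho'; nra.
    + intros x y; apply power_sum_near_id; unfold rho'; lra.
    + apply Rmax_r.
    + exact Hw2.
    + intros z t' Ht' Hz Hfz.
      (* If |z| > rho, then 2 |z| s < 1 and [power_sum_mean] force z to be a convex combination of
         z1 and z2, whose modulus is at most rho. *)
      apply Rnot_lt_le; intros Hlt.
      assert (Hu : Cmod z1 <= Cmod z) by (generalize (Rmax_l (Cmod z1) (Cmod z2)); fold rho; lra).
      assert (Hv : Cmod z2 <= Cmod z) by (generalize (Rmax_r (Cmod z1) (Cmod z2)); fold rho; lra).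
      assert (Hz' : Cmod z < 1 / 2) by (unfold rho' in Hz; lra).
      assert (Hc : (z - (RtoC t' * z1 + RtoC (1 - t') * z2))%C = RtoC 0).
      { apply (Cmod_contract_0 _ (2 * Cmod z * s)); [generalize (Cmod_ge_0 z); nra|].
        assert (H := power_sum_mean z z1 z2 t' Hu Hv (Rlt_le _ _ Hz') Ht').
        replace (power_sum d z - (RtoC t' * power_sum d z1 + RtoC (1 - t') * power_sum d z2))%C
          with (RtoC 0) in H; [exact H|].
        rewrite Hfz, Hw1, Hw2, RtoC_minus; ring. }
      apply Ceq_minus in Hc.
      assert (H := Cmod_triangle (RtoC t' * z1) (RtoC (1 - t') * z2)).
      rewrite <- Hc, !Cmod_mult, !Cmod_R, !Rabs_pos_eq in H by lra.
      generalize (Rmax_l (Cmod z1) (Cmod z2)) (Rmax_r (Cmod z1) (Cmod z2)); fold rho.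
      intros; nra.
    + exact Ht.
    + exists z; split; [unfold Cdisk; lra|].
      rewrite Hfz, RtoC_minus; ring.
Qed.

End PowerSum.

(** * The Gamma function *)

Definition half_line_integral (f : R -> R) (l : R) : Prop :=
  is_RInt_gen f (at_right 0) (Rbar_locally p_infty) l.

Lemma half_line_pos :
  filter_prod (at_right 0) (Rbar_locally p_infty)
    (fun ab : R * R => 0 < fst ab <= snd ab).
Proof.
  apply (Filter_prod _ _ _ (fun a => 0 < a < 1) (fun b => 1 < b)).
  - exists (mkposreal 1 Rlt_0_1); intros y Hy Hy0.
    apply Rabs_lt_between' in Hy; simpl in Hy. lra.
  - exists 1; tauto.
  - simpl; intros; lra.
Qed.

Lemma half_line_integral_ext (f g : R -> R) (l : R) :
  (forall t, 0 < t -> f t = g t) -> half_line_integral f l -> half_line_integral g l.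
Proof.
  intros Hfg; apply is_RInt_gen_ext.
  eapply filter_imp; [|apply half_line_pos].
  intros [a b] Hab t Ht; simpl in *; apply Hfg.
  rewrite Rmin_left in Ht by lra; lra.
Qed.

Lemma half_line_integral_ge_0 (f : R -> R) (l : R) :
  (forall t, 0 < t -> 0 <= f t) -> half_line_integral f l -> 0 <= l.
Proof.
  intros Hf Hl.
  apply Rle_trans with (norm l); [apply norm_ge_0|].
  apply (RInt_gen_norm (V := R_CompleteNormedModule) (Fa := at_right 0)
           (Fb := Rbar_locally p_infty) f f); try exact Hl.
  - eapply filter_imp; [|apply half_line_pos]. intros ab H; apply H.
  - eapply filter_imp; [|apply half_line_pos].
    intros ab Hab t Ht. change (Rabs (f t) <= f t).
    rewrite Rabs_pos_eq; [lra|]. apply Hf; lra.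
Qed.

(** For f >= 0 the integral over [a, b] grows with the interval, so its supremum is the limit. *)
Lemma half_line_integral_bounded (f : R -> R) (M : R) :
  (forall t, 0 < t -> 0 <= f t) -> (forall t, 0 < t -> continuous f t) ->
  (forall a b, 0 < a <= b -> RInt f a b <= M) ->
  exists l, half_line_integral f l.
Proof.
  intros Hpos Hcont HM.
  assert (Hex : forall a b, 0 < a <= b -> ex_RInt f a b).
  { intros a b Hab. apply (ex_RInt_continuous (V := R_CompleteNormedModule)).
    intros t Ht; apply Hcont. rewrite Rmin_left in Ht; lra. }
  destruct (completeness (fun v => exists a b, 0 < a <= b /\ v = RInt f a b)) as [l [Hl1 Hl2]].
  - exists M; intros v [a [b [Hab ->]]]; now apply HM.
  - exists (RInt f 1 1), 1, 1; split; [lra | reflexivity].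
  - exists l; intros P [eps HP].
    assert (Hnear : exists a b, 0 < a <= b /\ l - eps < RInt f a b).
    { apply NNPP; intros Hn.
      assert (l <= l - eps); [|generalize (cond_pos eps); lra].
      apply Hl2; intros v [a [b [Hab ->]]].
      apply Rnot_lt_le; intros Hlt; apply Hn; eauto. }
    destruct Hnear as [a0 [b0 [Hab0 Hlt]]].
    apply (Filter_prod _ _ _ (fun a => 0 < a < a0) (fun b => b0 < b)).
    + exists (mkposreal a0 (proj1 Hab0)); intros y Hy Hy0.
      apply Rabs_lt_between' in Hy; simpl in Hy; lra.
    + exists b0; tauto.
    + intros a b Ha Hb; simpl.
      exists (RInt f a b); split.
      * apply (RInt_correct (V := R_CompleteNormedModule)), Hex; lra.
      * apply HP. apply Rabs_lt_between'.
        assert (Hle : RInt f a b <= l) by (apply Hl1; exists a, b; split; [lra | reflexivity]).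
        assert (H1 : RInt f a b = RInt f a a0 + (RInt f a0 b0 + RInt f b0 b)).
        { rewrite <- (RInt_Chasles f a a0 b), <- (RInt_Chasles f a0 b0 b);
            try (apply Hex; lra). reflexivity. }
        assert (H2 : 0 <= RInt f a a0).
        { apply RInt_ge_0; [lra | apply Hex; lra | intros; apply Hpos; lra]. }
        assert (H3 : 0 <= RInt f b0 b).
        { apply RInt_ge_0; [lra | apply Hex; lra | intros; apply Hpos; lra]. }
        generalize (cond_pos eps); lra.
Qed.

Lemma half_line_integral_derive (F f : R -> R) (l0 l1 : R) :
  (forall t, 0 < t -> is_derive F t (f t)) -> (forall t, 0 < t -> continuous f t) ->
  filterlim F (at_right 0) (locally l0) ->
  filterlim F (Rbar_locally p_infty) (locally l1) ->
  half_line_integral f (l1 - l0).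
Proof.
  intros HF Hf H0 H1.
  apply half_line_integral_ext with (Derive F).
  { intros t Ht; now apply is_derive_unique, HF. }
  apply is_RInt_gen_Derive; try assumption.
  - eapply filter_imp; [|apply half_line_pos]. intros ab Hab t Ht.
    rewrite Rmin_left in Ht by lra. exists (f t); apply HF; lra.
  - eapply filter_imp; [|apply half_line_pos]. intros ab Hab t Ht.
    rewrite Rmin_left in Ht by lra.
    apply continuous_ext_loc with f; [|apply Hf; lra].
    assert (Hp : 0 < t) by lra.
    exists (mkposreal t Hp); intros u Hu.
    apply Rabs_lt_between' in Hu; simpl in Hu.
    symmetry; apply is_derive_unique, HF; lra.
Qed.

(** * Euler's integrand: bounds and limits, then the functional equation and monotonicity of
    Gamma *)

Definition gamma_kernel (x t : R) : R := Rpower t (x - 1) * exp (- t).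

Lemma gamma_kernel_pos (x t : R) : 0 < gamma_kernel x t.
Proof. apply Rmult_lt_0_compat; apply exp_pos. Qed.

Lemma gamma_kernel_derive (x t : R) : 0 < t ->
  is_derive (gamma_kernel x) t (((x - 1) / t - 1) * gamma_kernel x t).
Proof.
  intros Ht; unfold gamma_kernel, Rpower.
  auto_derive; [exact Ht|].
  field; lra.
Qed.

Lemma gamma_kernel_continuous (x t : R) : 0 < t -> continuous (gamma_kernel x) t.
Proof.
  intros Ht; apply (ex_derive_continuous (gamma_kernel x)).
  eexists; now apply gamma_kernel_derive.
Qed.

Lemma ln_le_minus_1 (u : R) : 0 < u -> ln u <= u - 1.
Proof.
  intros Hu; assert (H := exp_ineq1_le (ln u)).
  rewrite exp_ln in H by exact Hu; lra.
Qed.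

(** The bound ln u <= u - 1 at u = t / (2x) gives (x - 1) ln t <= (x - 1) ln (2x) + t/2, whence c =
    (2x)^(x-1). *)
Lemma gamma_kernel_le_exp (x : R) : 1 <= x ->
  exists c, 0 < c /\ forall t, 0 < t -> gamma_kernel x t <= c * exp (- t / 2).
Proof.
  intros Hx.
  exists (exp ((x - 1) * ln (2 * x))); split; [apply exp_pos|].
  intros t Ht; unfold gamma_kernel, Rpower.
  rewrite <- !exp_plus.
  apply Rnot_lt_le; intros H; apply exp_lt_inv in H.
  assert (Hu : 0 < t / (2 * x)) by (apply Rdiv_lt_0_compat; lra).
  assert (H1 := ln_le_minus_1 _ Hu).
  rewrite ln_div in H1 by lra.
  assert (H2 := Rmult_le_compat_l (x - 1) _ _ ltac:(lra) H1).
  assert (H3 : (x - 1) * (t / (2 * x)) <= t / 2).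
  { replace (t / 2) with (x * (t / (2 * x))) by (field; lra).
    apply Rmult_le_compat_r; lra. }
  lra.
Qed.

(** Convergence of Euler's integral: every integral over [a, b] is at most that of c e^(-t/2), hence
    at most 2c. *)
Lemma Gamma_correct (x : R) : 1 <= x -> half_line_integral (gamma_kernel x) (Gamma x).
Proof.
  intros Hx.
  destruct (gamma_kernel_le_exp x Hx) as [c [Hc Hle]].
  destruct (half_line_integral_bounded (gamma_kernel x) (2 * c)) as [l Hl].
  - intros t _; apply Rlt_le, gamma_kernel_pos.
  - intros t; apply gamma_kernel_continuous.
  - intros a b Hab.
    assert (Hi : is_RInt (fun t => c * exp (- t / 2)) a b
                   (minus (- 2 * c * exp (- b / 2)) (- 2 * c * exp (- a / 2)))).
    { apply (is_RInt_derive (fun t => - 2 * c * exp (- t / 2)) (fun t => c * exp (- t / 2))).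
      - intros t _; auto_derive; [trivial|]. unfold Rdiv; field.
      - intros t _. apply (ex_derive_continuous (fun t => c * exp (- t / 2))).
        auto_derive; trivial. }
    apply Rle_trans with (RInt (fun t => c * exp (- t / 2)) a b).
    + apply RInt_le; [lra | | eexists; exact Hi | intros t Ht; apply Hle; lra].
      apply (ex_RInt_continuous (V := R_CompleteNormedModule)).
      intros t Ht; apply gamma_kernel_continuous. rewrite Rmin_left in Ht; lra.
    + rewrite (is_RInt_unique _ _ _ _ Hi).
      change (- 2 * c * exp (- b / 2) - - 2 * c * exp (- a / 2) <= 2 * c).
      assert (H1 : exp (- a / 2) <= 1)
        by (rewrite <- exp_0; apply Rlt_le, exp_increasing; lra).
      assert (H2 := exp_pos (- b / 2)). nra.
  - assert (E : Gamma x = l) by (apply is_RInt_gen_unique; exact Hl).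
    rewrite E; exact Hl.
Qed.

Lemma Gamma_eq (x l : R) : half_line_integral (gamma_kernel x) l -> Gamma x = l.
Proof. intros H; apply is_RInt_gen_unique; exact H. Qed.

Lemma gamma_kernel_succ (x t : R) : 0 < t -> gamma_kernel (x + 1) t = t * gamma_kernel x t.
Proof.
  intros Ht; unfold gamma_kernel.
  replace (x + 1 - 1) with ((x - 1) + 1) by ring.
  rewrite Rpower_plus, Rpower_1 by exact Ht; ring.
Qed.

(** For t <= 1 and x - 1 >= 1 the kernel is at most t. *)
Lemma gamma_kernel_lim_0 (x : R) : 2 <= x ->
  filterlim (fun t => - gamma_kernel x t) (at_right 0) (locally 0).
Proof.
  intros Hx P [eps HP].
  assert (Hp : 0 < Rmin 1 eps) by (apply Rmin_glb_lt; [lra | apply cond_pos]).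
  exists (mkposreal _ Hp); intros t Ht Ht0.
  apply Rabs_lt_between' in Ht; simpl in Ht.
  assert (H1 := Rmin_l 1 eps); assert (H2 := Rmin_r 1 eps).
  apply HP, Rabs_lt_between'.
  assert (H3 := gamma_kernel_pos x t).
  enough (gamma_kernel x t <= t) by (generalize (cond_pos eps); lra).
  unfold gamma_kernel.
  replace t with (Rpower t 1 * 1) at 3 by (rewrite Rpower_1 by exact Ht0; ring).
  apply Rmult_le_compat; try (apply Rlt_le, exp_pos).
  - unfold Rpower. assert (ln t <= 0) by (generalize (ln_le_minus_1 t Ht0); lra).
    apply Rnot_lt_le; intros Hlt; apply exp_lt_inv in Hlt; nra.
  - rewrite <- exp_0; apply Rlt_le, exp_increasing; lra.
Qed.

(** The kernel for x + 1 is t times the one for x and is bounded by c, so the latter is at most c /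
    t. *)
Lemma gamma_kernel_lim_infty (x : R) : 1 <= x ->
  filterlim (fun t => - gamma_kernel x t) (Rbar_locally p_infty) (locally 0).
Proof.
  intros Hx P [eps HP].
  destruct (gamma_kernel_le_exp (x + 1)) as [c [Hc Hle]]; [lra|].
  assert (He := cond_pos eps).
  exists (c / eps); intros t Ht.
  assert (Hce : 0 < c / eps) by (apply Rdiv_lt_0_compat; lra).
  apply HP, Rabs_lt_between'.
  assert (H3 := gamma_kernel_pos x t).
  enough (gamma_kernel x t < eps) by lra.
  specialize (Hle t ltac:(lra)); rewrite gamma_kernel_succ in Hle by lra.
  assert (H1 : exp (- t / 2) <= 1)
    by (rewrite <- exp_0; apply Rlt_le, exp_increasing; lra).
  assert (Ht0 : 0 < t) by lra.
  apply Rlt_div_l in Ht; [|lra].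
  apply Rmult_lt_reg_l with t; [lra|]. nra.
Qed.

(** Integration by parts: - t^x e^(-t) is a primitive of the difference of the two integrands and
    vanishes at both ends. *)
Lemma Gamma_succ (x : R) : 1 <= x -> Gamma (x + 1) = x * Gamma x.
Proof.
  intros Hx; apply Gamma_eq.
  assert (H : half_line_integral (fun t => gamma_kernel (x + 1) t - x * gamma_kernel x t) (0 - 0)).
  { apply half_line_integral_derive with (fun t => - gamma_kernel (x + 1) t).
    - intros t Ht.
      assert (H := gamma_kernel_derive (x + 1) t Ht).
      apply is_derive_opp in H.
      replace (gamma_kernel (x + 1) t - x * gamma_kernel x t)
        with (opp (((x + 1 - 1) / t - 1) * gamma_kernel (x + 1) t)); [exact H|].
      change (- (((x + 1 - 1) / t - 1) * gamma_kernel (x + 1) t)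
              = gamma_kernel (x + 1) t - x * gamma_kernel x t).
      rewrite gamma_kernel_succ by exact Ht; field; lra.
    - intros t Ht.
      apply (continuous_minus (gamma_kernel (x + 1)) (fun t => x * gamma_kernel x t)).
      + now apply gamma_kernel_continuous.
      + apply (continuous_scal_r x (gamma_kernel x)). now apply gamma_kernel_continuous.
    - apply gamma_kernel_lim_0; lra.
    - apply gamma_kernel_lim_infty; lra. }
  assert (H1 := is_RInt_gen_plus _ _ _ _ H (is_RInt_gen_scal _ x _ (Gamma_correct x Hx))).
  replace (x * Gamma x) with ((0 - 0) + x * Gamma x) by ring.
  refine (half_line_integral_ext _ _ _ _ H1).
  intros t _; change (gamma_kernel (x + 1) t - x * gamma_kernel x t + x * gamma_kernel x t
                      = gamma_kernel (x + 1) t); ring.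
Qed.

Lemma Gamma_1 : Gamma 1 = 1.
Proof.
  apply Gamma_eq.
  replace 1 with (0 - - (1)) at 2 by ring.
  apply half_line_integral_derive with (fun t => - gamma_kernel 1 t).
  - intros t Ht.
    assert (H := gamma_kernel_derive 1 t Ht).
    apply is_derive_opp in H.
    replace (gamma_kernel 1 t) with (opp (((1 - 1) / t - 1) * gamma_kernel 1 t)); [exact H|].
    change (- (((1 - 1) / t - 1) * gamma_kernel 1 t) = gamma_kernel 1 t).
    field; lra.
  - intros t; apply gamma_kernel_continuous.
  (* At x = 1 the kernel does not vanish at 0: the primitive - e^(-t) tends to -1 there. *)
  - apply (filterlim_within_ext _ (fun t => - exp (- t))).
    + intros t Ht; unfold gamma_kernel.
      rewrite Rminus_diag, Rpower_O by exact Ht; ring.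
    + apply (filterlim_filter_le_1 (F := locally 0) (G := at_right 0));
        [apply filter_le_within; apply locally_filter|].
      replace (- (1)) with (- exp (- 0)) by (rewrite Ropp_0, exp_0; reflexivity).
      apply (ex_derive_continuous (fun t => - exp (- t)) 0). auto_derive; trivial.
  - apply gamma_kernel_lim_infty; lra.
Qed.

Lemma Gamma_ge_0 (x : R) : 1 <= x -> 0 <= Gamma x.
Proof.
  intros Hx; apply (half_line_integral_ge_0 _ _ (fun t _ => Rlt_le _ _ (gamma_kernel_pos x t))).
  now apply Gamma_correct.
Qed.

(* [t^(y-x) >= 1 + (y - x) ln t >= 1 + (y - x) (1 - 1/t)]; multiply by
   [t^(x-1) e^(-t)]. *)
Lemma gamma_kernel_convex (x y t : R) : 0 < t -> x <= y ->
  (y - x) * (gamma_kernel x t - gamma_kernel (x - 1) t)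
  <= gamma_kernel y t - gamma_kernel x t.
Proof.
  intros Ht Hxy.
  assert (E1 : gamma_kernel y t = exp ((y - x) * ln t) * gamma_kernel x t).
  { unfold gamma_kernel, Rpower; rewrite <- !exp_plus; f_equal; ring. }
  assert (E2 : gamma_kernel x t = t * gamma_kernel (x - 1) t).
  { rewrite <- gamma_kernel_succ by exact Ht; f_equal; ring. }
  assert (Hk := gamma_kernel_pos (x - 1) t).
  assert (H1 := exp_ineq1_le ((y - x) * ln t)).
  assert (H2 := ln_le_minus_1 (/ t) (Rinv_0_lt_compat _ Ht)).
  rewrite ln_Rinv in H2 by exact Ht.
  assert (H3 : (y - x) * (1 - / t) <= (y - x) * ln t) by (apply Rmult_le_compat_l; lra).
  assert (H4 : (y - x) * (1 - / t) * (t * gamma_kernel (x - 1) t)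
               <= (exp ((y - x) * ln t) - 1) * (t * gamma_kernel (x - 1) t)).
  { apply Rmult_le_compat_r; [apply Rmult_le_pos; lra | lra]. }
  replace ((y - x) * (1 - / t) * (t * gamma_kernel (x - 1) t))
    with ((y - x) * (t * gamma_kernel (x - 1) t - gamma_kernel (x - 1) t)) in H4
    by (field; lra).
  rewrite E1, E2; lra.
Qed.

(** Integrating [gamma_kernel_convex] bounds Gamma y - Gamma x below by (y - x) (Gamma x - Gamma (x
    - 1)) = (y - x) (x - 2) Gamma (x - 1). *)
Lemma Gamma_increasing (x y : R) : 2 <= x -> x <= y -> Gamma x <= Gamma y.
Proof.
  intros Hx Hxy.
  assert (Gx := Gamma_correct x ltac:(lra)).
  assert (Gy := Gamma_correct y ltac:(lra)).
  assert (Gp := Gamma_correct (x - 1) ltac:(lra)).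
  assert (H := is_RInt_gen_minus _ _ _ _
                 (is_RInt_gen_minus _ _ _ _ Gy Gx)
                 (is_RInt_gen_scal _ (y - x) _ (is_RInt_gen_minus _ _ _ _ Gx Gp))).
  apply half_line_integral_ge_0 in H.
  - change (0 <= (Gamma y - Gamma x) - (y - x) * (Gamma x - Gamma (x - 1))) in H.
    assert (E := Gamma_succ (x - 1) ltac:(lra)).
    replace (x - 1 + 1) with x in E by ring.
    assert (H1 := Gamma_ge_0 (x - 1) ltac:(lra)).
    assert (H2 : 0 <= (y - x) * ((x - 2) * Gamma (x - 1)))
      by (apply Rmult_le_pos; [lra | apply Rmult_le_pos; lra]).
    assert (E2 : Gamma x - Gamma (x - 1) = (x - 2) * Gamma (x - 1)) by (rewrite E; ring).
    rewrite E2 in H; lra.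
  - intros t Ht.
    change (0 <= (gamma_kernel y t - gamma_kernel x t)
                 - (y - x) * (gamma_kernel x t - gamma_kernel (x - 1) t)).
    assert (H1 := gamma_kernel_convex x y t Ht Hxy); lra.
Qed.

(** Strictness comes from monotonicity: x Gamma x = Gamma (x + 1) >= Gamma 2 = 1. *)
Lemma Gamma_pos (x : R) : 1 <= x -> 0 < Gamma x.
Proof.
  intros Hx.
  assert (H := Gamma_increasing 2 (x + 1) ltac:(lra) ltac:(lra)).
  replace 2 with (1 + 1) in H by ring.
  rewrite !Gamma_succ, Gamma_1 in H by lra.
  assert (H0 := Gamma_ge_0 x Hx). nra.
Qed.

(** * The coefficients of the Wright function *)

Definition wright_coeff (mu a nu b : R) (k : nat) : R :=
  Gamma a * Gamma b / (Gamma (a + INR k * mu) * Gamma (b + INR k * nu)).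

Lemma wright_coeff_pos (mu a nu b : R) (k : nat) :
  1 <= a -> 1 <= b -> 1 <= mu -> 1 <= nu -> 0 < wright_coeff mu a nu b k.
Proof.
  intros Ha Hb Hmu Hnu; assert (Hk := pos_INR k).
  apply Rdiv_lt_0_compat; apply Rmult_lt_0_compat; apply Gamma_pos; nra.
Qed.

Lemma wright_coeff_0 (mu a nu b : R) : 1 <= a -> 1 <= b -> wright_coeff mu a nu b 0 = 1.
Proof.
  intros Ha Hb; unfold wright_coeff; simpl INR; rewrite !Rmult_0_l, !Rplus_0_r.
  apply Rinv_r, Rmult_integral_contrapositive_currified;
    apply Rgt_not_eq, Gamma_pos; assumption.
Qed.

(** At a successor index the arguments of Gamma in the denominator are at least 2, where Gamma
    increases. *)
Lemma wright_coeff_le (mu a nu b : R) (k : nat) :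
  1 <= a -> 1 <= b -> 1 <= mu -> 1 <= nu ->
  wright_coeff mu a nu b (S k) <= wright_coeff 1 a 1 b (S k).
Proof.
  intros Ha Hb Hmu Hnu; assert (Hk := INR_S_ge_1 k).
  assert (H : forall x m, 1 <= x -> 1 <= m ->
            0 < Gamma (x + INR (S k) * 1) <= Gamma (x + INR (S k) * m)).
  { intros x m Hx Hm; split; [apply Gamma_pos; nra | apply Gamma_increasing; nra]. }
  assert (H1 := H a mu Ha Hmu); assert (H2 := H b nu Hb Hnu).
  apply Rmult_le_compat_l.
  - apply Rmult_le_pos; apply Gamma_ge_0; assumption.
  - apply Rinv_le_contravar; [apply Rmult_lt_0_compat; lra|].
    apply Rmult_le_compat; lra.
Qed.

Lemma wright_coeff_succ (a b : R) (k : nat) : 1 <= a -> 1 <= b ->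
  wright_coeff 1 a 1 b (S k)
  = wright_coeff 1 a 1 b k / ((a + INR k) * (b + INR k)).
Proof.
  intros Ha Hb; assert (Hk := pos_INR k).
  unfold wright_coeff; rewrite S_INR, !Rmult_1_r, <- !Rplus_assoc.
  rewrite !Gamma_succ by lra.
  assert (H1 := Gamma_pos (a + INR k) ltac:(lra)).
  assert (H2 := Gamma_pos (b + INR k) ltac:(lra)).
  field; repeat split; lra.
Qed.

(* The ratio of consecutive terms [(k + 2) c_(k+1)] is at most
   [4 / (3 (a + 2) (b + 2))] from [k = 1] on, and [(a + 2) (b + 2) >= 10]. *)
Lemma wright_coeff_tail (a b : R) (k : nat) : 1 <= a -> 1 <= b -> 2 <= a * b ->
  INR (S (S (S k))) * wright_coeff 1 a 1 b (S (S k))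
  <= 3 / (a * b * ((a + 1) * (b + 1))) * (1 / 7) ^ k.
Proof.
  intros Ha Hb Hab.
  induction k as [|k IH].
  - rewrite !wright_coeff_succ, wright_coeff_0 by assumption.
    simpl; right; field; lra.
  - rewrite wright_coeff_succ by assumption.
    assert (Hc := wright_coeff_pos 1 a 1 b (S (S k)) Ha Hb (Rle_refl _) (Rle_refl _)).
    set (c := wright_coeff 1 a 1 b (S (S k))) in *.
    set (B := 3 / _) in *.
    change ((1 / 7) ^ S k) with (1 / 7 * (1 / 7) ^ k).
    apply Rle_trans with (1 / 7 * (INR (S (S (S k))) * c)); [|lra].
    clear IH.
    rewrite (S_INR (S (S (S k)))), (S_INR (S (S k))), (S_INR (S k)), (S_INR k).
    assert (Hk := pos_INR k); set (x := INR k) in *; clearbody x c.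
    assert (HD : 10 <= (a + (x + 1 + 1)) * (b + (x + 1 + 1))) by nra.
    set (Q := (a + (x + 1 + 1)) * (b + (x + 1 + 1))) in *; clearbody Q.
    replace ((x + 1 + 1 + 1 + 1) * (c / Q)) with (c * ((x + 4) / Q)) by (field; lra).
    replace (1 / 7 * ((x + 1 + 1 + 1) * c)) with (c * ((x + 3) / 7)) by field.
    apply Rmult_le_compat_l; [lra|].
    (* With Q >= 10 this reduces to 7 (x + 4) <= 10 (x + 3). *)
    apply Rle_div_l; [lra|]. nra.
Qed.

(** The first term is at most 2 / (ab) and the others sum to at most 3 / (abM) times 7/6, where M =
    (a + 1) (b + 1). The last hypothesis says, with denominators cleared, that these bounds add up
    to at most 1. *)
Lemma wright_coeff_sum (mu a nu b : R) :
  1 <= a -> 1 <= b -> 1 <= mu -> 1 <= nu ->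
  2 * ((a + 1) * (b + 1)) + 7 / 2 <= a * b * ((a + 1) * (b + 1)) ->
  exists s, is_series (fun k => INR (S (S k)) * wright_coeff mu a nu b (S k)) s /\ s <= 1.
Proof.
  intros Ha Hb Hmu Hnu HM.
  set (M := (a + 1) * (b + 1)) in *.
  assert (HM4 : 4 <= M) by (unfold M; nra).
  assert (Hab : 2 <= a * b) by nra.
  set (u := fun k => INR (S (S k)) * wright_coeff mu a nu b (S k)).
  set (B := 3 / (a * b * M)).
  assert (Hg : is_series (fun k => B * (1 / 7) ^ k) (B * / (1 - 1 / 7)))
    by (apply is_series_scal_R, is_series_geom; rewrite Rabs_pos_eq; lra).
  assert (Hu : forall k, 0 <= u (S k) <= B * (1 / 7) ^ k).
  { intros k; split.
    - apply Rmult_le_pos; [apply pos_INR | now apply Rlt_le, wright_coeff_pos].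
    - eapply Rle_trans; [|now apply wright_coeff_tail].
      apply Rmult_le_compat_l; [apply pos_INR | now apply wright_coeff_le]. }
  assert (Hex : ex_series (fun k => u (S k)))
    by (apply (ex_series_le_R _ _ Hu); eexists; exact Hg).
  exists (Series u); split.
  - apply Series_correct. now apply ex_series_incr_1.
  - rewrite (Series_incr_1 u) by now apply ex_series_incr_1.
    assert (H1 := Series_le _ _ Hu (ex_intro _ _ Hg)).
    rewrite (is_series_unique _ _ Hg) in H1.
    assert (H0 : u 0%nat <= 2 / (a * b)).
    { unfold u.
      assert (H := wright_coeff_le mu a nu b 0 Ha Hb Hmu Hnu).
      rewrite wright_coeff_succ, wright_coeff_0 in H by assumption.
      simpl INR in H |- *; rewrite !Rplus_0_r in H.
      unfold Rdiv in *; lra. }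
    assert (H2 : 2 / (a * b) + B * / (1 - 1 / 7) = (2 * M + 7 / 2) / (a * b * M))
      by (unfold B; field; repeat split; nra).
    assert (H3 : (2 * M + 7 / 2) / (a * b * M) <= 1)
      by (apply Rle_div_l; nra).
    lra.
Qed.

(** The additional weight k + 3 <= 3 2^k only worsens the geometric ratio from 1/7 to 2/7. *)
Lemma wright_coeff_sqr_sum (mu a nu b : R) :
  1 <= a -> 1 <= b -> 1 <= mu -> 1 <= nu -> 2 <= a * b ->
  ex_series (fun k => INR (S k) ^ 2 * wright_coeff mu a nu b k).
Proof.
  intros Ha Hb Hmu Hnu Hab.
  apply ex_series_incr_1, ex_series_incr_1.
  set (B := 3 / (a * b * ((a + 1) * (b + 1)))).
  apply ex_series_le_R with (fun k => 3 * B * (2 / 7) ^ k).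
  - intros k.
    assert (Hc := wright_coeff_pos mu a nu b (S (S k)) Ha Hb Hmu Hnu).
    assert (Hle := wright_coeff_le mu a nu b (S k) Ha Hb Hmu Hnu).
    assert (Ht := wright_coeff_tail a b k Ha Hb Hab); fold B in Ht.
    split; [apply Rmult_le_pos; [apply pow2_ge_0 | lra]|].
    assert (H2 : INR (S (S (S k))) <= 3 * 2 ^ k).
    { clear; induction k as [|k IH]; [simpl; lra|].
      rewrite S_INR; change (2 ^ S k) with (2 * 2 ^ k).
      assert (H := pow_R1_Rle 2 k ltac:(lra)); lra. }
    replace (2 / 7) with (2 * (1 / 7)) by field; rewrite Rpow_mult_distr.
    assert (Hi := pos_INR (S (S (S k)))).
    set (i := INR (S (S (S k)))) in *.
    replace (i ^ 2 * wright_coeff mu a nu b (S (S k)))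
      with (i * (i * wright_coeff mu a nu b (S (S k)))) by ring.
    replace (3 * B * (2 ^ k * (1 / 7) ^ k)) with ((3 * 2 ^ k) * (B * (1 / 7) ^ k)) by ring.
    apply Rmult_le_compat; [exact Hi | nra | exact H2 |].
    eapply Rle_trans; [|exact Ht]. apply Rmult_le_compat_l; assumption.
  - eexists; apply is_series_scal_R, is_series_geom; rewrite Rabs_pos_eq; lra.
Qed.

(** * From the thresholds [psi1] and [psi2] to the coefficient condition *)

Lemma quadratic_root_le (A B D x : R) :
  0 < A -> 0 <= D -> (B + sqrt D) / (2 * A) <= x ->
  0 <= 2 * A * x - B /\ D <= (2 * A * x - B) ^ 2.
Proof.
  intros HA HD Hx.
  apply Rle_div_l in Hx; [|lra].
  assert (H := sqrt_pos D); split; [lra|].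
  rewrite <- (sqrt_sqrt D HD); nra.
Qed.

Lemma psi1_coeff_condition (a b : R) : 1 <= a -> 1 <= b -> psi1 a <= b ->
  2 * ((a + 1) * (b + 1)) + 7 / 2 <= a * b * ((a + 1) * (b + 1)).
Proof.
  intros Ha Hb Hpsi.
  apply quadratic_root_le in Hpsi; [|lra|nra].
  destruct Hpsi as [_ H].
  (* [psi1 a] is the larger root in b of this quadratic; 4a completes the square. *)
  assert (H1 : 0 <= a * b ^ 2 + a * b - 3 * b - 2).
  { apply Rmult_le_reg_l with (4 * a); [lra|]. lra. }
  assert (H2 : 5 / 2 <= a * b).
  { apply Rnot_lt_le; intros Hlt.
    assert (H3 : a * b * (b + 1) < 5 / 2 * (b + 1)) by (apply Rmult_lt_compat_r; lra).
    lra. }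
  (* This bounds the right-hand side of the goal below by (a + 1) (3b + 2), which exceeds the
     left-hand side by ab + b - 7/2 >= 0. *)
  assert (H3 : 0 <= (a + 1) * (a * b ^ 2 + a * b - 3 * b - 2))
    by (apply Rmult_le_pos; lra).
  lra.
Qed.

Lemma psi2_coeff_condition (a b : R) : 1 <= a -> 1 <= b -> psi2 a <= b ->
  2 * ((a + 1) * (b + 1)) + 7 / 2 <= a * b * ((a + 1) * (b + 1)).
Proof.
  intros Ha Hb Hpsi; unfold psi2 in Hpsi.
  assert (Hs2 : sqrt 5 * sqrt 5 = 5) by (apply sqrt_sqrt; lra).
  assert (Hs0 := sqrt_pos 5).
  set (r := sqrt 5) in *; clearbody r.
  (* The rational bound 11/5 for the square root of 5 is sharp enough for the final comparison. *)
  assert (Hr : 11 / 5 <= r) by nra.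
  replace (4 * a * (a + 1)) with (2 * (2 * a * (a + 1))) in Hpsi by ring.
  apply quadratic_root_le in Hpsi; [|nra|].
  - destruct Hpsi as [_ H].
    set (P := a * b + a + b).
    (* As a quadratic in b this has [psi2 a] as its larger root. With b >= 1 it gives abP >= 11/5 P
       + 33/10, and adding ab >= 11/5 yields 2P + 11/2 <= ab (P + 1). *)
    assert (H1 : 0 <= 2 * (a * b) * P - r * (2 * P + b + 2)).
    { apply Rmult_le_reg_l with (8 * a * (a + 1)); [nra|].
      assert (E : (2 * (2 * a * (a + 1)) * b - (r * (2 * a + 3) - 2 * a ^ 2)) ^ 2
                  = 16 * a ^ 2 * (a + 1) ^ 2 * b ^ 2
                    - 8 * a * (a + 1) * b * (r * (2 * a + 3) - 2 * a ^ 2)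
                    + (r * r) * (2 * a + 3) ^ 2
                    - 4 * r * (2 * a + 3) * a ^ 2 + 4 * a ^ 4) by ring.
      rewrite E, Hs2 in H. unfold P. lra. }
    assert (HP : 3 <= P) by (unfold P; nra).
    assert (H2 : 11 / 5 * (2 * P + 3) <= r * (2 * P + b + 2))
      by (apply Rmult_le_compat; lra).
    assert (H3 : 11 / 5 <= a * b).
    { apply Rmult_le_reg_r with P; [lra|]. lra. }
    replace ((a + 1) * (b + 1)) with (P + 1) by (unfold P; ring).
    lra.
  - assert (0 <= a ^ 2) by nra. assert (0 <= a ^ 3) by (apply pow_le; lra).
    assert (0 <= a ^ 4) by (apply pow_le; lra).
    assert (0 <= r * a ^ 3) by (apply Rmult_le_pos; lra).
    assert (0 <= r * a ^ 2) by (apply Rmult_le_pos; lra).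
    assert (0 <= r * a) by (apply Rmult_le_pos; lra).
    lra.
Qed.

Theorem theorem4p5 :
  forall a b mu nu : R, 1 <= a -> 1 <= b -> 1 <= mu -> 1 <= nu ->
    (psi1 a <= b -> convex_in (1 / 2) (wright mu a nu b)) /\
    (psi2 a <= b -> starlike_in 1 (wright mu a nu b)).
Proof.
  intros a b mu nu Ha Hb Hmu Hnu.
  set (d := fun k => RtoC (wright_coeff mu a nu b k)).
  assert (Hd : forall k, Cmod (d k) = wright_coeff mu a nu b k).
  { intros k; unfold d; rewrite Cmod_R.
    now apply Rabs_pos_eq, Rlt_le, wright_coeff_pos. }
  assert (d0 : d 0%nat = RtoC 1) by (unfold d; now rewrite wright_coeff_0).
  change (wright mu a nu b) with (power_sum d).
  assert (Hsum : 2 * ((a + 1) * (b + 1)) + 7 / 2 <= a * b * ((a + 1) * (b + 1)) ->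
    exists s, is_series (fun k => INR (S (S k)) * Cmod (d (S k))) s /\ s <= 1 /\
              ex_series (fun k => INR (S k) ^ 2 * Cmod (d k))).
  { intros HM.
    destruct (wright_coeff_sum mu a nu b Ha Hb Hmu Hnu HM) as [s [Hs Hs1]].
    exists s; split; [|split; [exact Hs1|]].
    - revert Hs; apply (is_series_ext (K := R_AbsRing) (V := R_NormedModule)).
      intros k; now rewrite Hd.
    - apply (ex_series_ext (K := R_AbsRing) (V := R_NormedModule)
               (fun k => INR (S k) ^ 2 * wright_coeff mu a nu b k)).
      + intros k; now rewrite Hd.
      + apply wright_coeff_sqr_sum; try assumption.
        (* Dividing [HM] by the positive M gives ab >= 2. *)
        assert (0 < (a + 1) * (b + 1)) by nra. nra. }
  split; intros Hpsi.
  - destruct (Hsum (psi1_coeff_condition a b Ha Hb Hpsi)) as [s [Hs [Hs1 H2]]].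
    now apply power_sum_convex with s.
  - destruct (Hsum (psi2_coeff_condition a b Ha Hb Hpsi)) as [s [Hs [Hs1 H2]]].
    now apply power_sum_starlike with s.
Qed.
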